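(* Let $(G_k)_{k\ge0}$ be one of the following families of trees: $G_k=(P_3^v:P_2^w)_k^{(3)}$ (the trees $GT_{1,k}$, with $P_3$ rooted at a leaf $v$); $G_k=(T_{1,3}^v:P_2^w)_k^{(2)}$, $(T_{1,3}^v:P_2^w)_{k,k+1}$, $(T_{1,3}^v:P_2^w)_{k,k+2}$; $G_k=(T_K^v:P_2^w)_k^{(2)}$, $(T_K^v:P_2^w)_{k,k+1}$, $(T_K^v:P_2^w)_{k,k+2}$, $(T_K^v:P_2^w)_{k,k+3}$. Then the set of non-isolated limit points of the zeros of the independence polynomials $I(G_k;x)$ is the circle $|x + 1/3| = 1/3$ in the complex plane. The same property holds for the family $(T_{m,t})_{t \geq 0}$ (for fixed $m$), provided there exists an integer $t_0$ such that the independence polynomial of $T_{m,t_0}$ is not log-concave.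
   Context: All graphs are finite and simple; $I(G;x)=\sum_i s_ix^i$ with $s_i$ the number of independent sets of size $i$. A sequence $s_0,\dots,s_n$ is log-concave if $s_i^2\ge s_{i-1}s_{i+1}$ for $1\le i\le n-1$; a polynomial is log-concave if its coefficient sequence is. Rooted graph constructions: for a rooted graph $H^w$ and $k\ge0$, $Z_k(H^w)$ is a new vertex $v_0$ joined to the roots of $k$ disjoint copies of $H$; $(G^v:H^w)_k$ is the disjoint union of $G$ and $Z_k(H^w)$ plus the edge $vv_0$, rooted at $v$; $(G^v:H^w)_{i_1,\ldots,i_j}=((G^v:H^w)_{i_1,\ldots,i_{j-1}}^v:H^w)_{i_j}$ (empty sequence giving $G^v$); $(G^v:H^w)_k^{(m)}$ uses $k$ repeated $m$ times. $P_t^w$ is the path on $t$ vertices rooted at a leaf $w$. $T_{m,t}^v=(P_1^v:P_2^w)_t^{(m)}$; in particular $T_{1,3}^v$ is a root $v$ with one child which carries three pendant 2-vertex paths. $T_K^v$ is a tree rooted at $v$ with a single child, to which a pendant 4-vertex path and two pendant 2-vertex paths are attached (each attached at an endpoint). A complex number $z$ is a limit point of zeros of the family if there exist zeros $z_k$ of $I(G_k;x)$ (for infinitely many $k$) with $z_k\to z$; the non-isolated limit points are those limit points that are accumulation points of the set of limit points. *)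

(* Defs.v *)
From HB Require Import structures.
From mathcomp Require Import all_boot all_order all_algebra.
From mathcomp Require Import complex.
From mathcomp Require Import all_classical all_reals topology normedtype.

Set Implicit Arguments.
Unset Strict Implicit.
Unset Printing Implicit Defensive.

Import Order.TTheory GRing.Theory Num.Theory.
Import numFieldNormedType.Exports.

Local Open Scope classical_set_scope.
Local Open Scope ring_scope.

Record graph := Graph {
  vertex :> finType;
  adj : rel vertex;
  adj_sym : symmetric adj;
  adj_irr : irreflexive adj }.

Record rooted_graph := RootedGraph {
  ungraph :> graph;
  rt : ungraph }.

Definition independent (G : graph) (S : {set G}) : bool :=
  [forall x in S, forall y in S, ~~ adj x y].

Definition num_indep (G : graph) (i : nat) : nat :=
  #|[set S : {set G} | independent S & #|S| == i]|.

Definition indep_poly (G : graph) : {poly int} :=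
  \poly_(i < #|G|.+1) (num_indep G i)%:R.

(* A polynomial coerces to the list of its coefficients up to its degree,
   so log_concave applies to polynomials as well. *)
Definition log_concave (s : seq int) : Prop :=
  forall i : nat, (0 < i < (size s).-1)%N -> s`_i.-1 * s`_i.+1 <= s`_i ^+ 2.

Section Path.
Variable t : nat.

Definition path_adj : rel 'I_t.-1.+1 :=
  fun i j => (i.+1 == j :> nat) || (j.+1 == i :> nat).

Lemma path_adj_sym : symmetric path_adj.
Proof. by move=> i j; rewrite /path_adj orbC. Qed.

Lemma path_adj_irr : irreflexive path_adj.
Proof. by move=> i; rewrite /path_adj orbb; apply/negbTE; rewrite neq_ltn ltnSn orbT. Qed.

(* The path on t vertices, t >= 1, rooted at an end vertex. *)
Definition rpath : rooted_graph :=
  @RootedGraph (Graph path_adj_sym path_adj_irr) (ord0 : 'I_t.-1.+1).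
End Path.

(* Z_k(H^w) : None is the new vertex v_0, and Some (i, x) is the vertex x of
   the i-th copy of H. *)
Section Fan.
Variables (H : rooted_graph) (k : nat).

Definition fan_adj : rel (option ('I_k * H)) := fun a b =>
  match a, b with
  | None, None => false
  | None, Some (_, y) => y == rt H
  | Some (_, x), None => x == rt H
  | Some (i, x), Some (j, y) => (i == j) && adj x y
  end.

Lemma fan_adj_sym : symmetric fan_adj.
Proof. by case=> [[i x]|] [[j y]|] //=; rewrite eq_sym adj_sym. Qed.

Lemma fan_adj_irr : irreflexive fan_adj.
Proof. by case=> [[i x]|] //=; rewrite adj_irr andbF. Qed.

Definition fan : rooted_graph :=
  @RootedGraph (Graph fan_adj_sym fan_adj_irr) (None : option ('I_k * H)).
End Fan.

(* The disjoint union of G and H plus an edge between the two roots, rooted at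
   the root of G. *)
Section Join.
Variables G H : rooted_graph.

Definition join_adj : rel (G + H) := fun a b =>
  match a, b with
  | inl x, inl y => adj x y
  | inr x, inr y => adj x y
  | inl x, inr y => (x == rt G) && (y == rt H)
  | inr x, inl y => (x == rt H) && (y == rt G)
  end.

Lemma join_adj_sym : symmetric join_adj.
Proof. by case=> x [] y //=; rewrite 1?adj_sym 1?andbC. Qed.

Lemma join_adj_irr : irreflexive join_adj.
Proof. by case=> x /=; rewrite adj_irr. Qed.

Definition join : rooted_graph :=
  @RootedGraph (Graph join_adj_sym join_adj_irr) (inl (rt G) : (G + H)%type).
End Join.

(* attach G H [:: i_1; ...; i_j] is (G^v : H^w)_(i_1, ..., i_j). *)
Definition attach (G H : rooted_graph) (s : seq nat) : rooted_graph :=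
  foldl (fun G' k => join G' (fan H k)) G s.

Definition T (m t : nat) : rooted_graph :=
  attach (rpath 1) (rpath 2) (nseq m t).

Definition TK : rooted_graph :=
  join (rpath 1)
    (join (join (join (rpath 1) (rpath 4)) (rpath 2)) (rpath 2)).

Section Zeros.
Variable C : numFieldType.

Definition indep_zero (G : graph) (z : C) : Prop :=
  root (map_poly intr (indep_poly G)) z.

Definition zero_limits (G : nat -> rooted_graph) : set C :=
  [set z | exists (k : nat -> nat) (u : nat -> C),
    [/\ {homo k : n p / (n < p)%N},
        forall n, indep_zero (G (k n)) (u n)
      & u @ \oo --> z]].

Definition nonisolated_zero_limits (G : nat -> rooted_graph) : set C :=
  zero_limits G `&` limit_point (zero_limits G).

End Zeros.

(* Main.v *)
Require Import Defs.
From mathcomp Require Import all_boot all_order all_algebra.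
From mathcomp Require Import complex all_classical all_reals topology normedtype.
From mathcomp Require Import ring.
Set Implicit Arguments.
Unset Strict Implicit.
Unset Printing Implicit Defensive.

Import Order.TTheory GRing.Theory Num.Theory.
Import numFieldNormedType.Exports.
Local Open Scope classical_set_scope.
Local Open Scope ring_scope.

(** Put a = 1 + 2x and b = 1 + x.  Splitting the independent sets of G according
   to whether they contain the root gives
     I((G : P_2)_(i_1, ..., i_m)) =
       I(G - v) prod_j (a^(i_j) + x b^(i_j)) + x I(G - N[v]) prod_j a^(i_j),
   so, when i_j = k + d_j, the polynomial is an exponential sum
   P_k = sum_J A_J L_J^k whose bases L_J are the monomials a^(m-j) b^j.  Neither
   extreme coefficient vanishes, since I(G) and I(G - v) have constant term 1.

   |a| = |b| is the circle |x + 1/3| = 1/3.  Off the circle a single base is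
   dominant, and a limit of zeros must be a zero of its coefficient.  On the
   circle, suppose that P_k has no zero in a fixed disc for all large k.  Then
   P_k'/P_k is a sum of deg P_k = O(k) terms 1/(x - c) with c outside the disc,
   so P_k'/(k P_k) is Lipschitz on a smaller disc uniformly in k.  But it tends to
   m a'/a on one side of the circle and to m b'/b on the other, and a'/a <> b'/b. *)

(** * Independence polynomials of rooted constructions *)

(** A sum over the independent sets themselves, so that bijections between sets turn into product
    formulas, and over any ring, so that the complex numbers can be used directly. *)
Definition ipoly (K : comNzRingType) (G : graph) : {poly K} :=
  \sum_(S : {set G} | independent S) 'X^#|S|.

(** This is I(G - v) for the root v, and [ipoly_in] is x I(G - N[v]); a condition on S replaces the
    deletion of vertices. *)
Definition ipoly_out (K : comNzRingType) (G : rooted_graph) : {poly K} :=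
  \sum_(S : {set G} | independent S && (rt G \notin S)) 'X^#|S|.

Definition ipoly_in (K : comNzRingType) (G : rooted_graph) : {poly K} :=
  \sum_(S : {set G} | independent S && (rt G \in S)) 'X^#|S|.

Lemma map_indep_poly (K : comNzRingType) (G : graph) :
  map_poly intr (indep_poly G) = ipoly K G.
Proof.
apply/polyP => i; rewrite coef_map /indep_poly coef_poly coef_sum /=.
transitivity ((num_indep G i)%:R : K).
  case: ltnP => [_|hi]; first by rewrite /= natz.
  rewrite rmorph0 /num_indep eq_card0 // => S; rewrite !inE.
  apply/negbTE/negP => /andP[_ /eqP hS].
  by have := max_card (mem S); rewrite hS leqNgt hi.
rewrite /num_indep -sum1dep_card natr_sum big_mkcondr /=.
by apply: eq_bigr => S _; rewrite coefXn eq_sym; case: eqP.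
Qed.

Lemma ipolyE (K : comNzRingType) (G : rooted_graph) :
  ipoly K G = ipoly_out K G + ipoly_in K G.
Proof.
by rewrite /ipoly (bigID (fun S : {set G} => rt G \in S)) /= addrC.
Qed.

Lemma independent0 (G : graph) : independent (finset.set0 : {set G}).
Proof. by apply/forallP => x; rewrite inE. Qed.

Lemma ipoly_out_coef0 (K : comNzRingType) (G : rooted_graph) :
  (ipoly_out K G)`_0 = 1.
Proof.
rewrite coef_sum (bigD1 finset.set0) ?independent0 ?inE //= cards0 coefXn eqxx.
rewrite big1 ?addr0 // => S /andP[_ hS].
by rewrite coefXn eq_sym cards_eq0 (negbTE hS).
Qed.

Lemma ipoly_in_coef0 (K : comNzRingType) (G : rooted_graph) :
  (ipoly_in K G)`_0 = 0.
Proof.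
rewrite coef_sum big1 // => S /andP[_ hS].
by rewrite coefXn eq_sym cards_eq0; case: eqP hS => // ->; rewrite inE.
Qed.

(** * Independent sets of a join *)

Definition join_set (G H : finType) (p : {set G} * {set H}) : {set G + H} :=
  [set x | match x with inl a => a \in p.1 | inr b => b \in p.2 end]%SET.

Definition split_set (G H : finType) (S : {set G + H}) : {set G} * {set H} :=
  ([set a | inl a \in S], [set b | inr b \in S])%SET.

Lemma join_setK (G H : finType) : cancel (@join_set G H) (@split_set G H).
Proof.
by move=> [A B]; congr pair; apply/setP => x; rewrite !inE.
Qed.

Lemma split_setK (G H : finType) : cancel (@split_set G H) (@join_set G H).
Proof. by move=> S; apply/setP => -[] x; rewrite !inE. Qed.

Lemma card_join_set (G H : finType) (p : {set G} * {set H}) :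
  #|join_set p| = (#|p.1| + #|p.2|)%N.
Proof.
rewrite -sum1_card big_mkcond big_sumType /= -!sum1_card.
by congr addn; rewrite [RHS]big_mkcond /=; apply: eq_bigr => x _; rewrite inE.
Qed.

Lemma independentP (G : graph) (S : {set G}) :
  reflect (forall x y, x \in S -> y \in S -> ~~ adj x y) (independent S).
Proof.
apply: (iffP forall_inP) => [h x y hx hy|h x hx].
  exact: (forall_inP (h x hx)).
by apply/forall_inP => y; apply: h.
Qed.

Lemma independent_join (G H : rooted_graph) (p : {set G} * {set H}) :
  @independent (join G H) (join_set p) =
  [&& independent p.1, independent p.2 & ~~ ((rt G \in p.1) && (rt H \in p.2))].
Proof.
apply/independentP/and3P => [h|[/independentP h1 /independentP h2 h3]].
  split.
  - by apply/independentP => x y hx hy; apply: (h (inl x) (inl y)); rewrite inE.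
  - by apply/independentP => x y hx hy; apply: (h (inr x) (inr y)); rewrite inE.
  - apply/negP => /andP[hG hH].
    by have := h (inl (rt G)) (inr (rt H)); rewrite !inE /= !eqxx => /(_ hG hH).
move=> [] x [] y; rewrite !inE => hx hy.
- exact: h1.
- by apply: contra h3 => /andP[/eqP <- /eqP <-]; rewrite hx hy.
- by apply: contra h3 => /andP[/eqP <- /eqP <-]; rewrite hx hy.
- exact: h2.
Qed.

(** When the root of G is absent, the joining edge imposes nothing on H; when it is present, as in
    [ipoly_in_join], it forces the root of H out. *)
Lemma ipoly_out_join (K : comNzRingType) (G H : rooted_graph) :
  ipoly_out K (join G H) = ipoly_out K G * ipoly K H.
Proof.
rewrite /ipoly_out (reindex (@join_set G H)) /=; last first.
  by exists (@split_set G H) => x _; rewrite ?join_setK ?split_setK.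
rewrite big_distrlr /= pair_big /=; apply: eq_big => p.
  rewrite independent_join inE.
  by case: (rt G \in p.1); rewrite /= ?andbF ?andbT.
by move=> _; rewrite card_join_set exprD.
Qed.

Lemma ipoly_in_join (K : comNzRingType) (G H : rooted_graph) :
  ipoly_in K (join G H) = ipoly_in K G * ipoly_out K H.
Proof.
rewrite /ipoly_in (reindex (@join_set G H)) /=; last first.
  by exists (@split_set G H) => x _; rewrite ?join_setK ?split_setK.
rewrite big_distrlr /= pair_big /=; apply: eq_big => p.
  rewrite independent_join inE.
  by case: (rt G \in p.1); rewrite /= ?andbF ?andbT.
by move=> _; rewrite card_join_set exprD.
Qed.

(** * Independent sets of a fan *)

Definition fan_set (H : finType) (k : nat) (p : bool * {ffun 'I_k -> {set H}}) :
    {set option ('I_k * H)} :=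
  [set x | if x is Some (i, y) then y \in p.2 i else p.1]%SET.

Definition unfan_set (H : finType) (k : nat) (S : {set option ('I_k * H)}) :
    bool * {ffun 'I_k -> {set H}} :=
  (None \in S, [ffun i => [set y | Some (i, y) \in S]%SET]).

Lemma fan_setK (H : finType) (k : nat) : cancel (@fan_set H k) (@unfan_set H k).
Proof.
move=> [b f]; rewrite /unfan_set inE; congr pair.
by apply/ffunP => i; apply/setP => y; rewrite ffunE !inE.
Qed.

Lemma unfan_setK (H : finType) (k : nat) : cancel (@unfan_set H k) (@fan_set H k).
Proof. by move=> S; apply/setP => -[[i y]|]; rewrite !inE ?ffunE ?inE. Qed.

Lemma card_fan_set (H : finType) (k : nat) (p : bool * {ffun 'I_k -> {set H}}) :
  #|fan_set p| = (p.1 + \sum_(i < k) #|p.2 i|)%N.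
Proof.
rewrite -sum1_card big_mkcond /= (bigD1 None) //= inE; congr addn.
transitivity (\sum_(q : 'I_k * H) (if q.2 \in p.2 q.1 then 1 else 0))%N.
  rewrite (reindex_omap (@Some _) id) //=; last by case.
  by apply: eq_big => [q|[i y] _]; rewrite ?eqxx ?inE.
rewrite -(pair_bigA _ (fun i y => if y \in p.2 i then 1 else 0)%N) /=.
by apply: eq_bigr => i _; rewrite -big_mkcond sum1_card.
Qed.

Lemma independent_fan (H : rooted_graph) (k : nat)
    (p : bool * {ffun 'I_k -> {set H}}) :
  @independent (fan H k) (fan_set p) =
  [forall i, independent (p.2 i) && (p.1 ==> (rt H \notin p.2 i))].
Proof.
apply/independentP/forallP => [h i|h].
  apply/andP; split.
    apply/independentP => x y hx hy.
    by have := h (Some (i, x)) (Some (i, y)); rewrite !inE /= eqxx; apply.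
  apply/implyP => hp; apply/negP => hr.
  by have := h None (Some (i, rt H)); rewrite !inE /= eqxx => /(_ hp hr).
have h1 i : independent (p.2 i) by case/andP: (h i).
have h2 i y : p.1 -> y \in p.2 i -> y != rt H.
  by move=> hp hy; case/andP: (h i) => _; rewrite hp /=; apply: contra => /eqP <-.
move=> [[i x]|] [[j y]|]; rewrite !inE //= => hx hy.
- apply/negP => /andP[/eqP ij]; apply/negP.
  by apply: (independentP _ (h1 i)) => //; rewrite ij.
- exact: h2 hx.
- exact: h2 hy.
Qed.

(** Without the new vertex the k copies are chosen freely, and distributivity expands the k-th power
    over families of independent sets. In [ipoly_in_fan] the new vertex contributes X and excludes
    the root of every copy. *)
Lemma ipoly_out_fan (K : comNzRingType) (H : rooted_graph) (k : nat) :
  ipoly_out K (fan H k) = ipoly K H ^+ k.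
Proof.
rewrite /ipoly_out (reindex (@fan_set H k)) /=; last first.
  by exists (@unfan_set H k) => x _; rewrite ?fan_setK ?unfan_setK.
transitivity (\sum_(f in ffun_on (fun S : {set H} => independent S))
    \prod_(i < k) ('X^#|f i| : {poly K})); last first.
  rewrite -iter_mulr_1 -big_const_ord; symmetry.
  exact: (bigA_distr_big _ (fun _ (S : {set H}) => 'X^#|S|)).
(* The Boolean component is pinned to [false]: the new vertex is not chosen. *)
rewrite (reindex_onto (fun f : {ffun 'I_k -> {set H}} => (false, f)) snd) /=; last first.
  by move=> [[] f] //=; rewrite inE andbF.
apply: eq_big => [f|f _]; last by rewrite card_fan_set expr_sum.
rewrite inE eqxx !andbT independent_fan /=.
by apply: eq_forallb => i /=; rewrite andbT.
Qed.

Lemma ipoly_in_fan (K : comNzRingType) (H : rooted_graph) (k : nat) :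
  ipoly_in K (fan H k) = 'X * ipoly_out K H ^+ k.
Proof.
rewrite /ipoly_in (reindex (@fan_set H k)) /=; last first.
  by exists (@unfan_set H k) => x _; rewrite ?fan_setK ?unfan_setK.
transitivity ('X *
    \sum_(f in ffun_on (fun S : {set H} => independent S && (rt H \notin S)))
    \prod_(i < k) ('X^#|f i| : {poly K})); last first.
  rewrite -iter_mulr_1 -big_const_ord; congr (_ * _); symmetry.
  exact: (bigA_distr_big _ (fun _ (S : {set H}) => 'X^#|S|)).
rewrite (reindex_onto (fun f : {ffun 'I_k -> {set H}} => (true, f)) snd) /=; last first.
  by move=> [[] f] //=; rewrite inE andbF.
rewrite big_distrr /=.
apply: eq_big => [f|f _]; last by rewrite card_fan_set exprS expr_sum.
by rewrite inE eqxx !andbT independent_fan.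
Qed.

(** * The two-vertex path and iterated attachment *)

Lemma ipoly_out_rpath2 (K : comNzRingType) : ipoly_out K (rpath 2) = 1 + 'X.
Proof.
rewrite /ipoly_out (bigD1 finset.set0) ?independent0 ?inE //= cards0; congr +%R.
rewrite (big_pred1 (finset.set1 (ord_max : 'I_2))) ?cards1 // => S /=.
apply/andP/eqP => [[/andP[_ h0] hS]|->]; last first.
  rewrite inE; split; last by apply/set0Pn; exists ord_max; rewrite inE.
  by apply/andP; split=> //; apply/independentP => x y; rewrite !inE => /eqP -> /eqP ->.
have/set0Pn[x hx] := hS.
have h1 : ord_max \in S.
  suff -> : ord_max = x :> 'I_2 by [].
  apply/val_inj; case: x hx => [[|[|]]] // hi hx; case/negP: h0.
  by rewrite (_ : ord0 = Ordinal hi) //; apply/val_inj.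
apply/setP => y; rewrite inE; case: (eqVneq y ord_max) => [->//|hy].
apply/negbTE; apply: contra h0; rewrite (_ : ord0 = y) //.
by apply/val_inj; case: y hy => [[|[|]]].
Qed.

Lemma ipoly_in_rpath2 (K : comNzRingType) : ipoly_in K (rpath 2) = 'X.
Proof.
rewrite /ipoly_in (big_pred1 (finset.set1 (ord0 : 'I_2))) ?cards1 // => S /=.
apply/andP/eqP => [[/independentP hi h0]|->]; last first.
  rewrite inE; split => //.
  by apply/independentP => x y; rewrite !inE => /eqP -> /eqP ->.
apply/setP => y; rewrite inE; apply/idP/eqP => [hy|->//]; apply/val_inj => /=.
by have := hi _ _ h0 hy; case: y hy => [[|[|]]].
Qed.

Lemma ipoly_rpath2 (K : comNzRingType) : ipoly K (rpath 2) = 1 + 'X *+ 2.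
Proof. by rewrite ipolyE ipoly_out_rpath2 ipoly_in_rpath2 -addrA. Qed.

(** Each attachment multiplies the part without the root by I(Z_k) and the part with the root by
    I(Z_k - v_0). The induction varies G because [attach] folds from the left. *)
Lemma ipoly_attach (K : comNzRingType) (G H : rooted_graph) (s : seq nat) :
  ipoly K (attach G H s) =
  ipoly_out K G * \prod_(k <- s) (ipoly K H ^+ k + 'X * ipoly_out K H ^+ k) +
  ipoly_in K G * \prod_(k <- s) ipoly K H ^+ k.
Proof.
elim: s G => [|k s IH] G; first by rewrite !big_nil !mulr1 ipolyE.
rewrite /attach /= -/(attach _ _ _) IH !big_cons ipoly_out_join ipoly_in_join.
by rewrite (ipolyE _ (fan H k)) ipoly_out_fan ipoly_in_fan !mulrA.
Qed.

(** * Zeros of exponential sums of polynomials *)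

(** In a general numeric field this rests on the Archimedean property, which the later limit
    arguments carry as a hypothesis. *)
Lemma cvg_inv_succn (C : numFieldType) (harch : Num.archimedean_axiom C) :
  (fun n : nat => (n.+1%:R)^-1 : C) @ \oo --> (0 : C).
Proof.
apply/cvgr0Pnorm_lt => e e0; have [N hN] := harch e^-1.
exists N => //= n /= hn; rewrite ger0_norm ?invr_ge0 ?ler0n // invf_plt ?posrE ?ltr0Sn //.
apply: le_lt_trans (real_ler_norm _) _; first by rewrite ger0_real ?invr_ge0 ?ltW.
by apply: lt_trans hN _; rewrite ltr_nat ltnS.
Qed.

Lemma bernoulli_ge (C : numFieldType) (h : C) (n : nat) :
  0 <= h -> 1 + n%:R * h <= (1 + h) ^+ n.
Proof.
move=> h0; elim: n => [|n IH]; first by rewrite mul0r addr0 expr0.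
rewrite exprS; apply: (@le_trans _ _ ((1 + h) * (1 + n%:R * h))); last first.
  by rewrite ler_wpM2l // addr_ge0.
have -> : (1 + h) * (1 + n%:R * h) = 1 + n.+1%:R * h + n%:R * h ^+ 2.
  by rewrite -natr1; ring.
by rewrite lerDl mulr_ge0 ?exprn_ge0.
Qed.

(** Since k is strictly increasing, k n >= n, so the powers are eventually at most p ^ n for a fixed
    p < 1; Bernoulli's inequality for 1 / p sends this to 0. *)
Lemma cvg_expr_var (C : numFieldType) (harch : Num.archimedean_axiom C)
    (r : nat -> C) (k : nat -> nat) (q : C) :
  {homo k : n p / (n < p)%N} -> 0 <= q < 1 ->
  (\forall n \near \oo, `|r n| <= q) ->
  (fun n => r n ^+ k n) @ \oo --> (0 : C).
Proof.
move=> hk /andP[q0 q1] hr.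
have hkn n : (n <= k n)%N.
  by elim: n => // n IH; apply: leq_ltn_trans IH _; apply: hk.
(* The midpoint of q and 1 is positive even when q = 0, so it can be inverted. *)
pose p := (q + 1) / 2.
have p0 : 0 < p by rewrite divr_gt0 // ltr_wpDl.
have p1 : p < 1 by rewrite ltr_pdivrMr // mul1r -[2%:R]/(1 + 1) ltrD2r.
have qp : q <= p.
  by rewrite ler_pdivlMr // -[2%:R]/(1 + 1) mulrDr mulr1 lerD2l ltW.
pose h := p^-1 - 1.
have h0 : 0 < h by rewrite subr_gt0 invf_pgt ?posrE // invr1.
have ph : p = (1 + h)^-1 by rewrite /h addrC subrK invrK.
clearbody h.
apply/cvgr0Pnorm_lt => e e0; have [N hN] := harch (e^-1 / h).
have [M _ hM] := hr.
exists (maxn N M) => //= n /=; rewrite geq_max => /andP[hNn hMn].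
have hrn : `|r n| <= p by apply: le_trans (hM _ _) qp.
have pn : p ^+ n < e.
  rewrite ph exprVn invf_plt ?posrE ?exprn_gt0 ?addr_gt0 //.
  apply: lt_le_trans (bernoulli_ge n (ltW h0)).
  rewrite ltr_wpDl // -ltr_pdivrMr //.
  apply: le_lt_trans (real_ler_norm _) _.
    by rewrite ger0_real // divr_ge0 ?invr_ge0 ?ltW.
  by apply: lt_le_trans hN _; rewrite ler_nat.
rewrite /= normrX; apply: le_lt_trans pn.
apply: (@le_trans _ _ (p ^+ k n)); first by rewrite lerXn2r ?nnegrE // ltW.
by apply: ler_wiXn2l; rewrite ?ltW.
Qed.

Lemma cvg_horner (C : numFieldType) (p : {poly C}) (u : nat -> C) (z : C) :
  u @ \oo --> z -> (fun n => p.[u n]) @ \oo --> p.[z].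
Proof.
move=> hu; elim/poly_ind: p => [|p c IH].
  under eq_fun do rewrite horner0; rewrite horner0; exact: cvg_cst.
under eq_fun do rewrite hornerMXaddC; rewrite hornerMXaddC.
by apply: cvgD; [apply: cvgM|apply: cvg_cst].
Qed.

Arguments cvg_horner {C} p {u z}.

Lemma cvg_sumr (C : numFieldType) (I : finType) (f : I -> nat -> C) (l : I -> C) :
  (forall i, f i @ \oo --> l i) ->
  (fun n => \sum_i f i n) @ \oo --> \sum_i l i.
Proof. by move=> hf; apply: cvg_big => //; apply: add_continuous. Qed.

(** * Exponential sums with a dominant base *)

Definition expsum (C : numFieldType) (I : finType) (A L : I -> {poly C})
  (k : nat) : {poly C} := \sum_i A i * L i ^+ k.

(** Nonvanishing is a separate clause because the inequalities say nothing when [i0] is the only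
    index. *)
Definition dominant (C : numFieldType) (I : finType) (L : I -> {poly C})
    (i0 : I) (z : C) : Prop :=
  (L i0).[z] != 0 /\ forall i, i != i0 -> `|(L i).[z]| < `|(L i0).[z]|.

(** After division by the dominant power, every other term carries a power of a ratio whose norm is
    eventually below a constant less than 1. The evaluation point moves with n so that sequences of
    zeros are covered. *)
Lemma cvg_expsum (C : numFieldType) (harch : Num.archimedean_axiom C)
    (I : finType) (A L : I -> {poly C}) (i0 : I) (k : nat -> nat)
    (u : nat -> C) (z : C) :
  dominant L i0 z -> {homo k : n p / (n < p)%N} -> u @ \oo --> z ->
  (fun n => (expsum A L (k n)).[u n] / (L i0).[u n] ^+ k n) @ \oo -->
  (A i0).[z].
Proof.
move=> [hz0 hz] hk hu.
have -> : (A i0).[z] = \sum_i (if i == i0 then (A i).[z] else 0).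
  by rewrite -big_mkcond big_pred1_eq.
have -> : (fun n => (expsum A L (k n)).[u n] / (L i0).[u n] ^+ k n) =
    (fun n => \sum_i (A i).[u n] * ((L i).[u n] / (L i0).[u n]) ^+ k n).
  apply/funext => n; rewrite horner_sum mulr_suml; apply: eq_bigr => i _.
  by rewrite hornerM horner_exp expr_div_n mulrA.
have cL i := cvg_horner (L i) hu.
apply: cvg_sumr => i; case: (eqVneq i i0) => [->|hi].
  apply: cvg_trans (cvg_horner (A i0) hu); apply: near_eq_cvg.
  apply: filterS (cvgr_neq0 _ (cL i0) hz0) => n hn.
  by rewrite divff // expr1n mulr1.
rewrite -[0](mulr0 (A i).[z]); apply: cvgM; first exact: cvg_horner.
have q1 : `|(L i).[z] / (L i0).[z]| < 1.
  by rewrite normf_div ltr_pdivrMr ?normr_gt0 // mul1r hz.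
have cq : (fun n => (L i).[u n] / (L i0).[u n]) @ \oo --> (L i).[z] / (L i0).[z].
  by apply: cvgM => //; apply: cvgV.
set q := `|_| in q1.
have q0 : 0 <= q by exact: normr_ge0.
(* The midpoint serves as a bound strictly between the limit ratio and 1. *)
have hq : q < (q + 1) / 2.
  by rewrite ltr_pdivlMr // -[2%:R]/(1 + 1) mulrDr mulr1 ltrD2l.
apply: (@cvg_expr_var _ harch _ _ ((q + 1) / 2)) => //.
  apply/andP; split; first by rewrite divr_ge0 ?addr_ge0 // ler0n.
  by rewrite ltr_pdivrMr // mul1r -[2%:R]/(1 + 1) ltrD2r.
by apply: filterS (cvgr_norm_lt _ cq _ hq) => n /ltW.
Qed.

(** Along zeros the normalised sums are constantly 0, hence so is their limit, the value of the
    dominant coefficient. *)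
Lemma expsum_zero_limit (C : numFieldType) (harch : Num.archimedean_axiom C)
    (I : finType) (A L : I -> {poly C}) (i0 : I) (k : nat -> nat)
    (u : nat -> C) (z : C) :
  dominant L i0 z -> {homo k : n p / (n < p)%N} -> u @ \oo --> z ->
  (forall n, root (expsum A L (k n)) (u n)) -> root (A i0) z.
Proof.
move=> hd hk hu hr; apply/eqP.
have := cvg_expsum harch (A := A) hd hk hu.
under eq_fun do rewrite (rootP (hr _)) mul0r.
by move=> h; apply: (cvg_unique _ h); [exact: norm_hausdorff|exact: cvg_cst].
Qed.

(** * Logarithmic derivatives and zeros near a point where dominance changes *)

Lemma deriv_expsumS (C : numFieldType) (I : finType) (A L : I -> {poly C}) (k : nat) :
  (expsum A L k.+1)^`() =
  expsum (fun i => (A i)^`()) L k.+1 +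
  (expsum (fun i => A i * (L i)^`()) L k) *+ k.+1.
Proof.
rewrite /expsum raddf_sum /= -sumrMnl -big_split /=; apply: eq_bigr => i _.
by rewrite derivM deriv_exp /= mulrnAr mulrA.
Qed.

(** In the derivative, the sum with coefficients A_i' is killed by the factor 1 / (k+1), while the
    one with coefficients A_i L_i' already carries k+1. In both, only the dominant base can
    survive. *)
Lemma cvg_logderiv_expsum (C : numFieldType) (harch : Num.archimedean_axiom C)
    (I : finType) (A L : I -> {poly C}) (i0 : I) (z : C) :
  dominant L i0 z -> ~~ root (A i0) z ->
  (fun k => (expsum A L k.+1)^`().[z] / (expsum A L k.+1).[z] / k.+1%:R) @ \oo
  --> (L i0)^`().[z] / (L i0).[z].
Proof.
move=> hd hA; have [hz0 _] := hd; have hA0 : (A i0).[z] != 0 by [].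
have cz : (fun _ : nat => z) @ \oo --> z by exact: cvg_cst.
have c1 B := cvg_expsum harch (A := B)
    hd (fun n p (h : (n < p)%N) => h : (n.+1 < p.+1)%N) cz.
have c0 B := cvg_expsum harch (A := B) hd (fun n p (h : (n < p)%N) => h) cz.
pose D := fun i => A i * (L i)^`().
(* [num k] is the derivative divided by k+1 and by the (k+1)-st power of the dominant base. *)
pose num k : C := (k.+1%:R)^-1 *
  ((expsum (fun i => (A i)^`()) L k.+1).[z] / (L i0).[z] ^+ k.+1) +
  (L i0).[z]^-1 * ((expsum D L k).[z] / (L i0).[z] ^+ k).
have cnum : num @ \oo --> (L i0).[z]^-1 * (D i0).[z].
  rewrite -[_ * _]add0r -[0 in X in _ --> X](mul0r ((A i0)^`()).[z]).
  apply: cvgD; apply: cvgM; [exact: cvg_inv_succn|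
    exact: (c1 (fun i => (A i)^`()))|exact: cvg_cst|exact: c0].
have -> : (L i0)^`().[z] / (L i0).[z] = (L i0).[z]^-1 * (D i0).[z] / (A i0).[z].
  by rewrite /D hornerM; field; rewrite hz0 hA0.
have -> : (fun k => (expsum A L k.+1)^`().[z] / (expsum A L k.+1).[z] / k.+1%:R) =
   (fun k => num k / ((expsum A L k.+1).[z] / (L i0).[z] ^+ k.+1)).
  apply/funext => k; rewrite /num deriv_expsumS hornerD hornerMn.
  (* If the sum vanishes at z, both sides are 0, as the inverse of 0 is 0. *)
  have [->|h] := eqVneq (expsum A L k.+1).[z] 0.
    by rewrite mul0r invr0 !mulr0 !mul0r.
  rewrite -[_ *+ k.+1]mulr_natl exprS; field.
  by rewrite h hz0 expf_neq0 // nat1r pnatr_eq0.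
by apply: cvgM => //; apply: cvgV => //; exact: c1.
Qed.

Lemma logderiv_prod_XsubC (F : fieldType) (s : seq F) (z : F) :
  z \notin s ->
  (\prod_(c <- s) ('X - c%:P))^`().[z] / (\prod_(c <- s) ('X - c%:P)).[z] =
  \sum_(c <- s) (z - c)^-1.
Proof.
elim: s => [|c s IH]; first by rewrite !big_nil derivC horner0 mul0r.
rewrite inE negb_or => /andP[hc hs]; rewrite !big_cons -IH //.
have hc' : z - c != 0 by rewrite subr_eq0.
have hp : (\prod_(c <- s) ('X - c%:P)).[z] != 0.
  by rewrite -[_ == 0]/(root _ z) root_prod_XsubC.
rewrite derivM derivXsubC mul1r !hornerE; field.
by rewrite hc' hp.
Qed.

(** The logarithmic derivative is the sum of 1 / (z - c) over the roots c, as many as the degree.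
    All roots are at distance at least r from z and z', so each term changes by at most |z - z'| /
    r^2. *)
Lemma logderiv_lipschitz (C : numClosedFieldType) (p : {poly C}) (z0 r z z' : C) :
  p != 0 -> 0 < r -> (forall x, root p x -> r + r <= `|x - z0|) ->
  `|z - z0| < r -> `|z' - z0| < r ->
  `|p^`().[z] / p.[z] - p^`().[z'] / p.[z']|
    <= (size p).-1%:R * (`|z - z'| / r ^+ 2).
Proof.
move=> p0 r0 hp hz hz'.
have [s ps] := closed_field_poly_normal p.
have lp0 : lead_coef p != 0 by rewrite lead_coef_eq0.
have far c y : c \in s -> `|y - z0| < r -> r <= `|y - c|.
  move=> hc hy; have hr : root p c by rewrite ps rootZ // root_prod_XsubC.
  rewrite -(lerD2r r); apply: le_trans (hp _ hr) _.
  have -> : c - z0 = (c - y) + (y - z0) by rewrite addrA subrK.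
  by apply: le_trans (ler_normD _ _) _; rewrite (distrC c) lerD2l ltW.
have logd y : `|y - z0| < r -> p^`().[y] / p.[y] = \sum_(c <- s) (y - c)^-1.
  move=> hy; rewrite ps derivZ !hornerZ -mulf_div divff // mul1r.
  apply: logderiv_prod_XsubC; apply/negP => /far/(_ hy).
  by rewrite subrr normr0 lt_geF.
rewrite !logd // -sumrB.
have -> : (size p).-1 = size s.
  by rewrite [in LHS]ps size_scale // size_prod_XsubC.
rewrite mulr_natl -(card_ord (size s)) -sumr_const big_tnth.
apply: le_trans (ler_norm_sum _ _ _) _; apply: ler_sum => i _.
have hi := mem_tnth i (in_tuple s).
have h1 := far _ _ hi hz; have h2 := far _ _ hi hz'.
set c := tnth _ _ in h1 h2 *.
have n1 : z - c != 0 by rewrite -normr_gt0 (lt_le_trans r0).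
have n2 : z' - c != 0 by rewrite -normr_gt0 (lt_le_trans r0).
have -> : (z - c)^-1 - (z' - c)^-1 = - (z - z') / ((z - c) * (z' - c)).
  by field; rewrite n1 n2.
rewrite normf_div normrN normrM ler_wpM2l // lef_pV2 ?posrE ?exprn_gt0 //.
  by rewrite expr2 ler_pM // ltW.
by rewrite mulr_gt0 ?normr_gt0.
Qed.

(** Linear growth of the degree makes the Lipschitz bound uniform in k after division by k+1. *)
Lemma size_expsum_le (C : numFieldType) (I : finType) (A L : I -> {poly C}) :
  exists M : nat, forall k, (size (expsum A L k.+1) <= M * k.+1)%N.
Proof.
exists (\sum_i (size (A i) + size (L i) + 1))%N => k.
apply: leq_trans (size_sum _ _ _) _; apply/bigmax_leqP => i _.
apply: (@leq_trans ((size (A i) + size (L i) + 1) * k.+1)); last first.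
  by rewrite leq_mul2r (bigD1 i) //= leq_addr.
apply: leq_trans (size_polyMleq _ _) _; apply: leq_trans (leq_pred _) _.
rewrite !mulnDl mul1n -addnA leq_add ?leq_pmulr //.
apply: leq_trans (size_poly_exp_leq _ _) _.
by rewrite -addn1 leq_add // leq_mul2r leq_pred orbT.
Qed.

Lemma cvg_norm_ub (C : numFieldType) (u : nat -> C) (l c : C) :
  0 <= c -> u @ \oo --> l -> (\forall n \near \oo, `|u n| <= c) -> `|l| <= c.
Proof.
move=> c0 hu hc; rewrite real_leNgt ?ger0_real //; apply/negP => hlt.
have [n [h1 h2]] := filter_ex (filterI (cvgr_norm_gt _ hu _ hlt) hc).
by have := lt_le_trans h1 h2; rewrite ltxx.
Qed.

(** Two bases dominate along two sequences tending to z0. If zeros avoided a disc around z0 from K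
    on, the uniform Lipschitz bound would force the logarithmic derivatives of the two bases to
    agree at z0. *)
Lemma expsum_zeros_near (C : numClosedFieldType)
    (harch : Num.archimedean_axiom C) (I : finType) (A L : I -> {poly C})
    (i j : I) (z0 : C) (v w : nat -> C) :
  v @ \oo --> z0 -> w @ \oo --> z0 ->
  (\forall n \near \oo, dominant L i (v n) /\ ~~ root (A i) (v n)) ->
  (\forall n \near \oo, dominant L j (w n) /\ ~~ root (A j) (w n)) ->
  (L i).[z0] != 0 -> (L j).[z0] != 0 ->
  (L i)^`().[z0] / (L i).[z0] != (L j)^`().[z0] / (L j).[z0] ->
  forall (e : C) (K : nat), 0 < e ->
  exists k x, [/\ (K <= k)%N, `|x - z0| < e & root (expsum A L k) x].
Proof.
move=> cv cw dv dw hi hj hD e K e0; apply: contrapT => hno.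
have [r [r0 er]] : exists r : C, 0 < r /\ e = r + r.
  by exists (e / 2); rewrite -splitr divr_gt0.
have far k x : (K <= k)%N -> root (expsum A L k) x -> r + r <= `|x - z0|.
  move=> hk hx; rewrite -er real_leNgt ?normr_real ?gtr0_real //; apply/negP => hlt.
  by apply: hno; exists k, x.
have [M hM] := size_expsum_le A L.
pose li x := (L i)^`().[x] / (L i).[x]; pose lj x := (L j)^`().[x] / (L j).[x].
(* Here n is fixed and k tends to infinity; each normalised logarithmic derivative tends to that of
   its dominant base. *)
have lip : \forall n \near \oo,
    `|li (v n) - lj (w n)| <= M%:R * (`|v n - w n| / r ^+ 2).
  near=> n.
  have [d1 a1] : dominant L i (v n) /\ ~~ root (A i) (v n) by near: n.
  have [d2 a2] : dominant L j (w n) /\ ~~ root (A j) (w n) by near: n.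
  have bv : `|v n - z0| < r by near: n; exact: cvgr_distC_lt.
  have bw : `|w n - z0| < r by near: n; exact: cvgr_distC_lt.
  have c0 : 0 <= `|v n - w n| / r ^+ 2 by rewrite divr_ge0 ?exprn_ge0 // ltW.
  apply: cvg_norm_ub (cvgB (cvg_logderiv_expsum harch d1 a1)
                           (cvg_logderiv_expsum harch d2 a2)) _.
    by rewrite mulr_ge0.
  exists K => // k /= hk; rewrite -mulrBl normrM.
  rewrite normfV normr_nat ler_pdivrMr ?ltr0Sn //.
  have hk1 : (K <= k.+1)%N by apply: leq_trans hk _.
  (* The zero polynomial would have z0 itself as a root. *)
  have p0 : expsum A L k.+1 != 0.
    apply/eqP => p0; have := far k.+1 z0 hk1; rewrite p0 root0 => /(_ isT).
    by rewrite subrr normr0 lt_geF ?addr_gt0.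
  apply: le_trans (logderiv_lipschitz p0 r0 (fun x => far _ x hk1) bv bw) _.
  rewrite mulrAC ler_wpM2r // -natrM ler_nat.
  exact: leq_trans (leq_pred _) (hM k).
(* Now n tends to infinity: the difference tends to its value at z0, and its bound tends to 0. *)
have cD : (fun n => li (v n) - lj (w n)) @ \oo --> li z0 - lj z0.
  by apply: cvgB; apply: cvgM; [exact: cvg_horner|apply: cvgV => //; exact: cvg_horner
    |exact: cvg_horner|apply: cvgV => //; exact: cvg_horner].
have cZ : (fun n => M%:R * (`|v n - w n| / r ^+ 2)) @ \oo --> (0 : C).
  rewrite -(mulr0 M%:R) -(mul0r (r ^+ 2)^-1) -[0 in X in _ --> X](normr0 C).
  rewrite -(subrr z0).
  apply: cvgM; first exact: cvg_cst.
  by apply: cvgM; [apply: cvg_norm; exact: cvgB|exact: cvg_cst].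
move/eqP: hD; apply; apply/eqP; rewrite -subr_eq0 -/(li _) -/(lj _); apply/eqP.
apply: (cvg_unique _ cD); first exact: norm_hausdorff.
apply/cvgr0Pnorm_lt => d d0; near=> n.
have hn : `|li (v n) - lj (w n)| <= M%:R * (`|v n - w n| / r ^+ 2) by near: n.
have hn' : `|M%:R * (`|v n - w n| / r ^+ 2)| < d by near: n; exact: cvgr0_norm_lt.
apply: le_lt_trans hn _; apply: le_lt_trans hn'; apply: real_ler_norm.
by rewrite ger0_real // mulr_ge0 // divr_ge0 // exprn_ge0 // ltW.
Unshelve. all: by end_near. Qed.

Lemma zero_limits_of_accumulation (C : numFieldType) (harch : Num.archimedean_axiom C)
    (G : nat -> rooted_graph) (z : C) :
  (forall (e : C) (K : nat), 0 < e ->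
    exists k x, [/\ (K <= k)%N, `|x - z| < e & indep_zero (G k) x]) ->
  zero_limits G z.
Proof.
move=> h.
have step (n K : nat) : exists kx : nat * C, [/\ (K <= kx.1)%N,
    `|kx.2 - z| < n.+1%:R^-1 & indep_zero (G kx.1) kx.2].
  have [|k [x [h1 h2 h3]]] := h n.+1%:R^-1 K; first by rewrite invr_gt0 ltr0Sn.
  by exists (k, x).
pose f n := projT1 (choice (step n)).
have hf n K := projT2 (choice (step n)) K; rewrite -/(f _) in hf.
(* Asking for an index beyond the previous one makes the chosen indices strictly increasing. *)
pose kx := fix kx n := if n is m.+1 then f n (kx m).1.+1 else f 0%N 0%N.
have kxP n : `|(kx n).2 - z| < n.+1%:R^-1 /\ indep_zero (G (kx n).1) (kx n).2.
  by case: n => [|n]; [have [] := hf 0%N 0%N|have [] := hf n.+1 (kx n).1.+1].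
exists (fun n => (kx n).1), (fun n => (kx n).2); split.
- apply: homo_ltn; first exact: ltn_trans.
  by move=> n; have [] := hf n.+1 (kx n).1.+1.
- by move=> n; have [] := kxP n.
- apply/cvgrPdistC_lt => e e0.
  apply: filterS (cvgr0_norm_lt _ (cvg_inv_succn harch) _ e0) => n hn.
  apply: lt_trans (proj1 (kxP n)) _; apply: le_lt_trans hn.
  by apply: real_ler_norm; rewrite ger0_real // invr_ge0 ler0n.
Qed.

(** * The circle *)

(** Once the power of X - z is factored out, the cofactor is nonzero at z and hence along a tail of
    u, while the power vanishes only at z. *)
Lemma cvg_nonroot (C : numFieldType) (p : {poly C}) (u : nat -> C) (z : C) :
  p != 0 -> u @ \oo --> z -> (forall n, u n != z) ->
  \forall n \near \oo, ~~ root p (u n).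
Proof.
move=> p0 cu hu; have [m [q]] := multiplicity_XsubC p z; rewrite p0 => /= qz ->.
apply: filterS (cvgr_neq0 _ (cvg_horner q cu) qz) => n hn.
rewrite rootM negb_or; apply/andP; split => //.
by rewrite rootE horner_exp !hornerE expf_neq0 // subr_eq0.
Qed.

Lemma limit_point_cvg (C : numFieldType) (harch : Num.archimedean_axiom C)
    (E : set C) (z : C) :
  limit_point E z ->
  exists u : nat -> C, [/\ u @ \oo --> z, forall n, u n != z & forall n, E (u n)].
Proof.
move=> hz.
have step (n : nat) : exists y : C, [/\ y != z, E y & `|z - y| < n.+1%:R^-1].
  have [|y [h1 h2 h3]] := hz (ball z n.+1%:R^-1); last by exists y.
  by apply: nbhsx_ballx; rewrite invr_gt0 ltr0Sn.
pose u n := projT1 (choice step).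
have hu n := projT2 (choice step) n.
exists (projT1 (choice step)); split=> [|n|n]; [|by have [] := hu n|by have [] := hu n].
apply/cvgrPdist_lt => e e0.
apply: filterS (cvgr0_norm_lt _ (cvg_inv_succn harch) _ e0) => n hn.
have [_ _ h] := hu n; apply: lt_trans h _; apply: le_lt_trans hn.
by apply: real_ler_norm; rewrite ger0_real // invr_ge0 ler0n.
Qed.

Lemma cvg_limit_point (C : numFieldType) (E : set C) (u : nat -> C) (z : C) :
  u @ \oo --> z -> (forall n, u n != z) -> (forall n, E (u n)) -> limit_point E z.
Proof.
move=> cu hu hE U hU; have [n hn] := @filter_ex _ \oo _ _ (cu _ hU).
by exists (u n).
Qed.

(** The locus |a| = |b| is a circle of Apollonius; the identity also tells its two sides apart. *)
Lemma norm_affine_sqr (C : numClosedFieldType) (z : C) :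
  `|1 + z *+ 2| ^+ 2 - `|1 + z| ^+ 2 = 3 * (`|z + 1 / 3| ^+ 2 - (1 / 3) ^+ 2).
Proof.
have h3 : (1 / 3)^* = 1 / 3 :> C by rewrite conj_Creal // ger0_real // divr_ge0.
by rewrite !normCK mulr2n !rmorphD /= h3 rmorph1; field.
Qed.

Lemma norm_affine_gt (C : numClosedFieldType) (z : C) :
  (`|1 + z| < `|1 + z *+ 2|) = (1 / 3 < `|z + 1 / 3|).
Proof.
have h3 : 0 <= 1 / 3 :> C by rewrite divr_ge0 ?ler0n.
rewrite -[LHS](@ltr_pXn2r _ 2) ?nnegrE // -[RHS](@ltr_pXn2r _ 2) ?nnegrE //.
by rewrite -subr_gt0 norm_affine_sqr pmulr_rgt0 ?ltr0n // subr_gt0.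
Qed.

Lemma norm_affine_lt (C : numClosedFieldType) (z : C) :
  (`|1 + z *+ 2| < `|1 + z|) = (`|z + 1 / 3| < 1 / 3).
Proof.
have h3 : 0 <= 1 / 3 :> C by rewrite divr_ge0 ?ler0n.
rewrite -[LHS](@ltr_pXn2r _ 2) ?nnegrE // -[RHS](@ltr_pXn2r _ 2) ?nnegrE //.
by rewrite -subr_lt0 norm_affine_sqr pmulr_rlt0 ?ltr0n // subr_lt0.
Qed.

(** For real t the Cayley transform (1 + it) / (1 - it) has norm 1. With t = 1 / (n+1) it rotates z
    to other points of the circle that tend to z. *)
Lemma circle_limit_point (C : numClosedFieldType)
    (harch : Num.archimedean_axiom C) (c r z : C) :
  z != c -> `|z - c| = r -> limit_point [set x | `|x - c| = r] z.
Proof.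
move=> zc zr; pose t n : C := n.+1%:R^-1.
have t0 n : 0 < t n by rewrite invr_gt0 ltr0Sn.
have tconj n : (t n)^* = t n by rewrite conj_Creal // gtr0_real.
have conjD n : (1 + 'i * t n)^* = 1 - 'i * t n.
  by rewrite rmorphD rmorph1 rmorphM /= conjCi tconj mulNr.
(* If this number were 0, so would be its conjugate, but the two add up to 2. *)
have nz n : 1 - 'i * t n != 0.
  apply/negP => /eqP h; have h' : 1 + 'i * t n = 0 by rewrite -[LHS]conjCK conjD h conjC0.
  have : (2 : C) = (1 - 'i * t n) + (1 + 'i * t n) by ring.
  by move/eqP; rewrite h h' addr0 pnatr_eq0.
pose u n := c + (z - c) * ((1 + 'i * t n) / (1 - 'i * t n)).
have ct : t @ \oo --> (0 : C) by exact: cvg_inv_succn.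
have cit : (fun n => 'i * t n) @ \oo --> (0 : C).
  by rewrite -[0](mulr0 'i); apply: cvgM => //; exact: cvg_cst.
apply: (@cvg_limit_point _ _ u).
- have -> : z = c + (z - c) * ((1 + 0) / (1 - 0)).
    by rewrite addr0 subr0 divr1 mulr1 addrC subrK.
  apply: cvgD; first exact: cvg_cst.
  apply: cvgM; first exact: cvg_cst.
  apply: cvgM; first by apply: cvgD => //; exact: cvg_cst.
  apply: cvgV; first by rewrite subr0 oner_eq0.
  by apply: cvgB => //; exact: cvg_cst.
- move=> n; rewrite -subr_eq0.
  have -> : u n - z = (z - c) * ('i * t n *+ 2) / (1 - 'i * t n).
    by rewrite /u; field; exact: nz.
  rewrite !mulf_neq0 ?subr_eq0 ?invr_eq0 // mulrn_eq0 /=.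
  by rewrite mulf_neq0 ?neq0Ci // gt_eqF.
- move=> n /=; rewrite /u addrC addKr normrM normf_div -conjD norm_conjC.
  rewrite divff ?mulr1 //.
  by rewrite normr_eq0 -conjC_eq0 conjD nz.
Qed.

(** * The exponential sum of an attachment family *)

Lemma prod_if_lt (C : numFieldType) (m : nat) (J : {set 'I_m}) (x y : C) :
  0 <= x -> x < y -> J != finset.set0 ->
  \prod_(i < m) (if i \in J then x else y) < y ^+ m.
Proof.
move=> x0 xy /set0Pn[i hi]; have y0 := le_lt_trans x0 xy.
rewrite -[m in y ^+ m]card_ord -prodr_const (bigD1 i) //= hi [ltRHS](bigD1 i) //=.
apply: (@le_lt_trans _ _ (x * \prod_(j < m | j != i) y)).
  rewrite ler_wpM2l // ler_prod // => j _.
  by case: ifP => _; rewrite ?lexx ?(ltW xy) ?x0 ?(ltW y0).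
by rewrite ltr_pM2r // prodr_gt0.
Qed.

(** J marks the attachments that contribute a power of b, so this is a^(m-|J|) b^|J|. Subsets of
    equal size share a base, but the empty and the full set are alone in their sizes. *)
Definition fan_base (F : comNzRingType) (m : nat) (J : {set 'I_m}) : {poly F} :=
  \prod_(i < m) (if i \in J then 1 + 'X else 1 + 'X *+ 2).

(** [ds] lists the offsets d_j; A0 and A1 stand for I(G - v) and x I(G - N[v]). The A1 term goes to
    the empty set, since its product contains powers of a only. *)
Definition fan_coef (F : comNzRingType) (A0 A1 : {poly F}) (ds : seq nat)
    (J : {set 'I_(size ds)}) : {poly F} :=
  A0 * \prod_(i < size ds)
    (if i \in J then 'X * (1 + 'X) ^+ nth 0%N ds i
     else (1 + 'X *+ 2) ^+ nth 0%N ds i) +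
  (if J == finset.set0 then
     A1 * \prod_(i < size ds) (1 + 'X *+ 2) ^+ nth 0%N ds i else 0).

Lemma fan_base0 (F : comNzRingType) (m : nat) :
  fan_base F (finset.set0 : {set 'I_m}) = (1 + 'X *+ 2) ^+ m.
Proof.
rewrite /fan_base -[in RHS](card_ord m) -prodr_const.
by apply: eq_bigr => i _; rewrite inE.
Qed.

Lemma fan_baseT (F : comNzRingType) (m : nat) :
  fan_base F (finset.setT : {set 'I_m}) = (1 + 'X) ^+ m.
Proof.
rewrite /fan_base -[in RHS](card_ord m) -prodr_const.
by apply: eq_bigr => i _; rewrite inE.
Qed.

Lemma fan_expsum (F : numFieldType) (A0 A1 : {poly F}) (ds : seq nat) (k : nat) :
  A0 * \prod_(d <- map (addn k) ds) ((1 + 'X *+ 2) ^+ d + 'X * (1 + 'X) ^+ d) +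
  A1 * \prod_(d <- map (addn k) ds) (1 + 'X *+ 2) ^+ d =
  expsum (@fan_coef F A0 A1 ds) (@fan_base F (size ds)) k.
Proof.
have nthE f : \prod_(d <- ds) f d = \prod_(i < size ds) f (nth 0%N ds i) :> {poly F}.
  by rewrite (big_nth 0%N) big_mkord.
rewrite !big_map !nthE.
(* With the b-term first, membership in J in the expansion means that this term is chosen. *)
under eq_bigr do rewrite addrC.
rewrite bigA_distr /expsum mulr_sumr.
under [RHS]eq_bigr do rewrite mulrDl; rewrite [RHS]big_split /=; congr +%R.
  apply: eq_bigr => J _; rewrite -mulrA; congr (_ * _).
  rewrite /fan_base -prodrXl -big_split /=; apply: eq_bigr => i _.
  by case: ifP => _; rewrite addnC exprD ?mulrA.
rewrite [RHS](bigD1 finset.set0) //= eqxx [X in _ = _ + X]big1 ?addr0; last first.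
  by move=> J hJ; rewrite (negbTE hJ) mul0r.
rewrite fan_base0 -mulrA; congr (_ * _).
rewrite -[X in _ ^+ X ^+ _](card_ord (size ds)) -prodr_const -prodrXl -big_split /=.
by apply: eq_bigr => i _; rewrite addnC exprD.
Qed.

Lemma horner_fan_base0 (C : numFieldType) (m : nat) (z : C) :
  (fan_base C (finset.set0 : {set 'I_m})).[z] = (1 + z *+ 2) ^+ m.
Proof. by rewrite fan_base0 horner_exp hornerD hornerMn hornerX hornerC. Qed.

Lemma horner_fan_baseT (C : numFieldType) (m : nat) (z : C) :
  (fan_base C (finset.setT : {set 'I_m})).[z] = (1 + z) ^+ m.
Proof. by rewrite fan_baseT horner_exp hornerD hornerX hornerC. Qed.

Lemma norm_fan_base (C : numFieldType) (m : nat) (J : {set 'I_m}) (z : C) :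
  `|(fan_base C J).[z]| =
  \prod_(i < m) (if i \in J then `|1 + z| else `|1 + z *+ 2|).
Proof.
rewrite horner_prod normr_prod; apply: eq_bigr => i _.
by case: ifP => _; rewrite !hornerE.
Qed.

Lemma dominant_fan0 (C : numFieldType) (m : nat) (z : C) :
  `|1 + z| < `|1 + z *+ 2| -> dominant (@fan_base C m) finset.set0 z.
Proof.
move=> hz; have n0 : `|(fan_base C (finset.set0 : {set 'I_m})).[z]| = `|1 + z *+ 2| ^+ m.
  by rewrite horner_fan_base0 normrX.
split; last by move=> J hJ; rewrite n0 norm_fan_base prod_if_lt.
by rewrite -normr_eq0 n0 expf_neq0 // gt_eqF // (le_lt_trans _ hz).
Qed.

Lemma dominant_fanT (C : numFieldType) (m : nat) (z : C) :
  `|1 + z *+ 2| < `|1 + z| -> dominant (@fan_base C m) finset.setT z.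
Proof.
move=> hz; have nT : `|(fan_base C (finset.setT : {set 'I_m})).[z]| = `|1 + z| ^+ m.
  by rewrite horner_fan_baseT normrX.
split; last first.
  move=> J hJ; rewrite nT norm_fan_base.
  (* Exchanging a and b replaces J by its complement, which is nonempty because J is not full. *)
  rewrite (eq_bigr (fun i => if i \in (~: J)%SET then `|1 + z *+ 2| else `|1 + z|)).
    rewrite prod_if_lt //; apply: contra hJ => /eqP hJ.
    by rewrite -(finset.setCK J) hJ finset.setC0.
  by move=> i _; rewrite inE; case: ifP.
by rewrite -normr_eq0 nT expf_neq0 // gt_eqF // (le_lt_trans _ hz).
Qed.

Lemma poly_coef0_neq0 (F : nzRingType) (p : {poly F}) : p`_0 = 1 -> p != 0.
Proof. by move=> hp; apply/eqP => p0; move/eqP: hp; rewrite p0 coef0 eq_sym oner_eq0. Qed.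

(** For the empty set both terms share the powers of a, leaving the factor A0 + A1, which is I(G) in
    the application. *)
Lemma fan_coef0_neq0 (F : fieldType) (A0 A1 : {poly F}) (ds : seq nat) :
  A0 + A1 != 0 -> fan_coef A0 A1 (finset.set0 : {set 'I_(size ds)}) != 0.
Proof.
move=> hA; rewrite /fan_coef eqxx.
under eq_bigr do rewrite inE.
rewrite -mulrDl mulf_neq0 //; apply/prodf_neq0 => i _; apply: expf_neq0.
by apply: poly_coef0_neq0; rewrite coefD coefMn coefX coef1 mul0rn addr0.
Qed.

(** For nonempty [ds] the full set is not empty, so the A1 term is absent and a product of nonzero
    factors remains. *)
Lemma fan_coefT_neq0 (F : fieldType) (A0 A1 : {poly F}) (ds : seq nat) :
  ds != [::] -> A0 != 0 -> fan_coef A0 A1 (finset.setT : {set 'I_(size ds)}) != 0.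
Proof.
move=> hds hA; rewrite /fan_coef ifF; last first.
  by rewrite -cards_eq0 cardsT card_ord size_eq0 (negbTE hds).
rewrite addr0 mulf_neq0 //; apply/prodf_neq0 => i _.
rewrite inE mulf_neq0 ?polyX_eq0 // expf_neq0 //.
by apply: poly_coef0_neq0; rewrite coefD coefX coef1 addr0.
Qed.

Lemma logderiv_exp (F : fieldType) (p : {poly F}) (m : nat) (z : F) :
  p.[z] != 0 ->
  (p ^+ m)^`().[z] / (p ^+ m).[z] = m%:R * (p^`().[z] / p.[z]).
Proof.
move=> pz; case: m => [|m]; first by rewrite expr0 derivC horner0 !mul0r.
rewrite deriv_exp hornerMn hornerM !horner_exp exprS -mulr_natl /=.
have pm : p.[z] ^+ m != 0 by exact: expf_neq0.
by field; rewrite pz pm.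
Qed.

(** m a'/a - m b'/b = m / (ab), because a'b - ab' = 2b - a = 1. *)
Lemma logderiv_fan_neq (C : numFieldType) (m : nat) (z : C) :
  (0 < m)%N -> 1 + z *+ 2 != 0 -> 1 + z != 0 ->
  let L0 := fan_base C (finset.set0 : {set 'I_m}) in
  let LT := fan_base C (finset.setT : {set 'I_m}) in
  L0^`().[z] / L0.[z] != LT^`().[z] / LT.[z].
Proof.
move=> m0 h2 h1 /=.
have ea : (1 + 'X *+ 2 : {poly C}).[z] = 1 + z *+ 2 by rewrite !hornerE.
have eb : (1 + 'X : {poly C}).[z] = 1 + z by rewrite !hornerE.
have da : (1 + 'X *+ 2 : {poly C})^`().[z] = 2.
  by rewrite !derivD derivC !derivX add0r hornerD hornerC.
have db : (1 + 'X : {poly C})^`().[z] = 1 by rewrite derivD derivC derivX add0r hornerC.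
rewrite fan_base0 fan_baseT !logderiv_exp ?ea ?eb // da db -subr_eq0.
set x := _ - _; have -> : x = m%:R / ((1 + z *+ 2) * (1 + z)).
  by rewrite /x; field; rewrite h1 mulr_natr.
by rewrite mulf_neq0 ?invr_eq0 ?mulf_neq0 // pnatr_eq0 -lt0n.
Qed.

Lemma indep_zero_attach (C : numFieldType) (G : rooted_graph) (ds : seq nat)
    (k : nat) (z : C) :
  indep_zero (attach G (rpath 2) (map (addn k) ds)) z =
  root (expsum (@fan_coef C (ipoly_out C G) (ipoly_in C G) ds)
               (@fan_base C (size ds)) k) z.
Proof.
rewrite /indep_zero map_indep_poly ipoly_attach ipoly_rpath2 ipoly_out_rpath2.
by rewrite fan_expsum.
Qed.

(** * Limits of zeros on and off the circle *)

Lemma circle_approx (C : numClosedFieldType) (harch : Num.archimedean_axiom C) (z : C) :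
  `|z + 1 / 3| = 1 / 3 ->
  exists v w : nat -> C, [/\ v @ \oo --> z, w @ \oo --> z,
    forall n, v n != z /\ 1 / 3 < `|v n + 1 / 3| &
    forall n, w n != z /\ `|w n + 1 / 3| < 1 / 3].
Proof.
move=> hz; pose t n : C := n.+1%:R^-1; pose d := z + 1 / 3.
have ct : t @ \oo --> (0 : C) by exact: cvg_inv_succn.
have t0 n : 0 < t n by rewrite invr_gt0 ltr0Sn.
have t1 n : t n <= 1 by rewrite invf_le1 ?ltr0Sn // ler1n.
have h3 : 0 < 1 / 3 :> C by rewrite divr_gt0 ?ltr0n.
have d0 : d != 0 by rewrite -normr_eq0 hz gt_eqF.
have cdt : (fun n => d * t n) @ \oo --> (0 : C).
  by rewrite -[0](mulr0 d); apply: cvgM => //; exact: cvg_cst.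
have dt0 n : d * t n != 0 by rewrite mulf_neq0 // gt_eqF.
(* Radial displacement multiplies the distance from the centre -1/3 by 1 + t or 1 - t. *)
exists (fun n => z + d * t n), (fun n => z - d * t n); split.
- by rewrite -[X in _ --> X]addr0; apply: cvgD => //; exact: cvg_cst.
- by rewrite -[X in _ --> X]subr0; apply: cvgB => //; exact: cvg_cst.
- move=> n; split; first by rewrite -subr_eq0 addrC addKr.
  have -> : z + d * t n + 1 / 3 = d * (1 + t n) by rewrite /d; ring.
  rewrite normrM hz ltr_pMr // ger0_norm ?addr_ge0 ?(ltW (t0 n)) //.
  by rewrite ltrDl.
- move=> n; split; first by rewrite -subr_eq0 addrC addKr oppr_eq0.
  have -> : z - d * t n + 1 / 3 = d * (1 - t n) by rewrite /d; ring.
  rewrite normrM hz gtr_pMr // ger0_norm ?subr_ge0 //.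
  by rewrite gtrBl.
Qed.

Lemma circle_sub_zero_limits (C : numClosedFieldType)
    (harch : Num.archimedean_axiom C) (G : rooted_graph) (ds : seq nat) :
  ds != [::] ->
  [set z : C | `|z + 1 / 3| = 1 / 3] `<=`
  zero_limits (fun k => attach G (rpath 2) (map (addn k) ds)).
Proof.
move=> hds z hz; apply: zero_limits_of_accumulation => // e K e0.
have [v [w [cv cw hv hw]]] := circle_approx harch hz.
have h3 : 0 < 1 / 3 :> C by rewrite divr_gt0 ?ltr0n.
have eqn : `|1 + z *+ 2| = `|1 + z|.
  apply/eqP; rewrite -(@eqrXn2 _ 2) // -subr_eq0 norm_affine_sqr hz subrr.
  by rewrite mulr0.
(* On the circle a and b have equal norm, so if one vanished both would, against 2b - a = 1. *)
have z2 : 1 + z *+ 2 != 0.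
  apply/eqP => h; have h1 : 1 + z = 0 by apply/eqP; rewrite -normr_eq0 -eqn h normr0.
  have : (1 : C) = (1 + z) *+ 2 - (1 + z *+ 2) by ring.
  by move/eqP; rewrite h h1 mul0rn subrr oner_eq0.
have z1 : 1 + z != 0 by rewrite -normr_eq0 -eqn normr_eq0.
have m0 : (0 < size ds)%N by rewrite lt0n size_eq0.
have A00 : ipoly_out C G != 0 by apply: poly_coef0_neq0; exact: ipoly_out_coef0.
have A10 : ipoly_out C G + ipoly_in C G != 0.
  by apply: poly_coef0_neq0; rewrite coefD ipoly_out_coef0 ipoly_in_coef0 addr0.
(* The power of a dominates along [v], outside the circle, and the power of b along [w], inside
   it. *)
have [|||||k [x [hk hx hr]]] := @expsum_zeros_near C harch _
  (@fan_coef C (ipoly_out C G) (ipoly_in C G) ds) (@fan_base C (size ds))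
  finset.set0 finset.setT z v w cv cw _ _ _ _ _ e K e0.
- apply: filterS (cvg_nonroot (fan_coef0_neq0 ds A10) cv (fun n => proj1 (hv n))) => n hn.
  by split=> //; apply: dominant_fan0; rewrite norm_affine_gt; case: (hv n).
- apply: filterS (cvg_nonroot (fan_coefT_neq0 _ hds A00) cw (fun n => proj1 (hw n)))
    => n hn.
  by split; [apply: dominant_fanT; rewrite norm_affine_lt; case: (hw n)|exact: hn].
- by rewrite horner_fan_base0 expf_neq0.
- by rewrite horner_fan_baseT expf_neq0.
- exact: logderiv_fan_neq.
- by exists k, x; split=> //; rewrite indep_zero_attach.
Qed.

(** Limits of zeros near z would all be roots of one dominant coefficient, and the roots of a
    nonzero polynomial do not accumulate. *)
Lemma dominant_not_limit_point (C : numClosedFieldType)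
    (harch : Num.archimedean_axiom C) (I : finType) (A L : I -> {poly C}) (i : I)
    (G : nat -> rooted_graph) (z : C) :
  (forall k x, indep_zero (G k) x = root (expsum A L k) x) -> A i != 0 ->
  (forall u : nat -> C, u @ \oo --> z -> \forall n \near \oo, dominant L i (u n)) ->
  ~ limit_point (zero_limits G : set C) z.
Proof.
move=> hG A0 hd /(limit_point_cvg harch)[u [cu hu hE]].
have [n [d /negP hn]] := filter_ex (filterI (hd u cu) (cvg_nonroot A0 cu hu)).
have [k [x [hk hr cx]]] := hE n; apply: hn.
by apply: (expsum_zero_limit harch d hk cx) => p; rewrite -hG.
Qed.

Lemma nonisolated_zero_limits_attach (C : numClosedFieldType)
    (harch : Num.archimedean_axiom C) (G : rooted_graph) (ds : seq nat) :
  ds != [::] ->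
  nonisolated_zero_limits (fun k => attach G (rpath 2) (map (addn k) ds)) =
  [set z : C | `|z + 1 / 3| = 1 / 3].
Proof.
move=> hds; apply/seteqP; split=> z; last first.
  move=> hz; split; first exact: circle_sub_zero_limits.
  have h3 : 0 < 1 / 3 :> C by rewrite divr_gt0 ?ltr0n.
  have : limit_point [set x : C | `|x - - (1 / 3)| = 1 / 3] z.
    apply: circle_limit_point => //; last by rewrite opprK.
    by rewrite -subr_eq0 opprK -normr_eq0 hz gt_eqF.
  (* All of the circle consists of limits of zeros, so its limit points are limit points of that
     set. *)
  move=> hl U hU; have [y [h1 h2 h4]] := hl U hU; exists y; split=> //.
  by apply: circle_sub_zero_limits => //; move: h2; rewrite /= opprK.
move=> [_ hl] /=; apply/eqP/negPn/negP => hz.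
have A00 : ipoly_out C G != 0 by apply: poly_coef0_neq0; exact: ipoly_out_coef0.
have A10 : ipoly_out C G + ipoly_in C G != 0.
  by apply: poly_coef0_neq0; rewrite coefD ipoly_out_coef0 ipoly_in_coef0 addr0.
have cz (u : nat -> C) : u @ \oo --> z -> (fun n => u n + 1 / 3) @ \oo --> z + 1 / 3.
  by move=> cu; apply: cvgD => //; exact: cvg_cst.
have hG k x := @indep_zero_attach C G ds k x.
have : `|z + 1 / 3| < 1 / 3 \/ 1 / 3 < `|z + 1 / 3|.
  by apply/orP; rewrite -real_neqr_lt // ger0_real // divr_ge0.
(* Both inequalities are open conditions, so the same extreme base dominates along a tail of every
   sequence tending to z. *)
case=> hz'; move: hl.
- apply: (dominant_not_limit_point harch hG (fan_coefT_neq0 _ hds A00)) => u cu.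
  apply: filterS (cvgr_norm_lt _ (cz _ cu) _ hz') => n hn.
  by apply: dominant_fanT; rewrite norm_affine_lt.
- apply: (dominant_not_limit_point harch hG (fan_coef0_neq0 ds A10)) => u cu.
  apply: filterS (cvgr_norm_gt _ (cz _ cu) _ hz') => n hn.
  by apply: dominant_fan0; rewrite norm_affine_gt.
Qed.

(** * The families of the theorem *)

Lemma complex_archimedean (R : realType) : Num.archimedean_axiom R[i].
Proof.
move=> x; exists (Num.bound (complex.Re `|x|)).
have -> : `|x| = (complex.Re `|x|)%:C%C by rewrite RRe_real // normr_real.
rewrite -(rmorph_nat (real_complex R)) ltcR.
by apply: archi_boundP; rewrite -ler0c RRe_real ?normr_real.
Qed.

Lemma log_concave_T0 (t : nat) : log_concave (indep_poly (T 0 t)).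
Proof.
move=> i /andP[i0 hi]; exfalso; move: hi; rewrite /T /=.
have : (size (indep_poly (rpath 1)) <= 2)%N.
  by apply: leq_trans (size_poly _ _) _; rewrite card_ord.
by case: (size _) => [|[|[|]]] //=; case: i i0.
Qed.

Theorem theorem4p1 (R : realType) :
  let on_circle (G : nat -> rooted_graph) :=
    nonisolated_zero_limits G = [set z : R[i] | `|z + 1 / 3| = 1 / 3] in
  on_circle (fun k => attach (rpath 3) (rpath 2) (nseq 3 k)) /\
  on_circle (fun k => attach (T 1 3) (rpath 2) (nseq 2 k)) /\
  on_circle (fun k => attach (T 1 3) (rpath 2) [:: k; (k + 1)%N]) /\
  on_circle (fun k => attach (T 1 3) (rpath 2) [:: k; (k + 2)%N]) /\
  on_circle (fun k => attach TK (rpath 2) (nseq 2 k)) /\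
  on_circle (fun k => attach TK (rpath 2) [:: k; (k + 1)%N]) /\
  on_circle (fun k => attach TK (rpath 2) [:: k; (k + 2)%N]) /\
  on_circle (fun k => attach TK (rpath 2) [:: k; (k + 3)%N]) /\
  (forall m : nat,
     (exists t0 : nat, ~ log_concave (indep_poly (T m t0))) ->
     on_circle (T m)).
Proof.
move=> on_circle.
(* Equal indices correspond to offsets that are all 0, and a pair k, k + d to the offsets 0 and
   d. *)
have circle_nseq G m : on_circle (fun k => attach G (rpath 2) (nseq m.+1 k)).
  rewrite /on_circle -(@nonisolated_zero_limits_attach _ (@complex_archimedean R)
    G (nseq m.+1 0%N)) //.
  by congr nonisolated_zero_limits; apply/funext => k; rewrite map_nseq addn0.
have circle_pair G d : on_circle (fun k => attach G (rpath 2) [:: k; (k + d)%N]).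
  rewrite /on_circle -(@nonisolated_zero_limits_attach _ (@complex_archimedean R)
    G [:: 0%N; d]) //.
  by congr nonisolated_zero_limits; apply/funext => k /=; rewrite addn0.
do 8 (split; [exact: circle_nseq || exact: circle_pair|]).
(* For m = 0 every tree of the family is a single vertex, which the failure of log-concavity
   excludes. *)
move=> [|m] [t0 ht0]; first by case: ht0; exact: log_concave_T0.
exact: circle_nseq.
Qed.
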